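(* Let $q$ be a prime power and let $n,r,k$ be positive integers with $k<rn$. Let $V$ be an $r$-dimensional $\mathbb{F}_{q^n}$-vector space, $W$ an $(rn-k)$-dimensional $\mathbb{F}_q$-vector space, $U$ a $k$-dimensional $\mathbb{F}_q$-subspace of $V$, and $G:V\to W$ an $\mathbb{F}_q$-linear map with $\ker(G)=U$. Define $$\iota=\max\{\dim_{\mathbb{F}_q}(U\cap\langle\mathbf{v}\rangle_{\mathbb{F}_{q^n}}) : \mathbf{v}\in V\setminus\{\mathbf 0\}\}.$$ For $\mathbf v\in V$ let $\tau_{\mathbf v}:\mathbb{F}_{q^n}\to V$, $\lambda\mapsto\lambda\mathbf v$, and $\Gamma_{\mathbf v}=G\circ\tau_{\mathbf v}:\mathbb{F}_{q^n}\to W$. If $\iota<n$, then $$\mathcal{C}_{U,G}=\{\Gamma_{\mathbf{v}}=G\circ \tau_{\mathbf{v}} : \mathbf{v} \in V\}$$ is an $\mathbb{F}_q$-linear rank metric code of $\mathbb{F}_q$-dimension $rn$ with parameters $(rn-k,n,q;n-\iota)$, whose right idealiser contains $\mathcal{F}_n$.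
   Context: For $\mathbb{F}_q$-vector spaces $W_1,W_2$ of dimensions $n$ and $m$, an $\mathbb{F}_q$-linear rank metric code with parameters $(m,n,q;d)$ is an $\mathbb{F}_q$-subspace $\mathcal{C}$ of $\mathrm{Hom}_{\mathbb{F}_q}(W_1,W_2)$ (equivalently, of $\mathbb{F}_q^{m\times n}$ after choosing bases) whose minimum distance, i.e. the minimum rank of a nonzero element, is $d$. The right idealiser of $\mathcal{C}\subseteq\mathrm{Hom}_{\mathbb{F}_q}(W_1,W_2)$ is $R(\mathcal{C})=\{Z\in\mathrm{End}_{\mathbb{F}_q}(W_1): f\circ Z\in\mathcal{C}\text{ for all } f\in\mathcal{C}\}$. For $\alpha\in\mathbb{F}_{q^n}$ let $\omega_\alpha:\mathbb{F}_{q^n}\to\mathbb{F}_{q^n}$, $x\mapsto\alpha x$, and $\mathcal{F}_n=\{\omega_\alpha:\alpha\in\mathbb{F}_{q^n}\}$, a field isomorphic to $\mathbb{F}_{q^n}$. *)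

(* Defs.v *)
From HB Require Import structures.
From mathcomp Require Import all_boot all_order all_algebra all_field.
Set Implicit Arguments.
Unset Strict Implicit.
Unset Printing Implicit Defensive.
Import GRing.Theory.
Local Open Scope ring_scope.

(* Same pattern as baseFieldType in fieldext.v, for vector spaces instead of
   field extensions: res_scal V is convertible to V, but carries an F-vector
   space structure when V is a vector space over the extension L of F. *)
Section RestrictionOfScalars.

Variables (F : fieldType) (L : fieldExtType F) (V : vectType L).

Definition res_scal : Type := V.
Notation V0 := res_scal.

HB.instance Definition _ := GRing.Zmodule.on V0.

Definition res_scal_scale (a : F) (v : V0) : V0 := (a%:A : L) *: (v : V).
Local Infix "*F:" := res_scal_scale (at level 40).

Fact res_scal_scaleA a b v : a *F: (b *F: v) = (a * b) *F: v.
Proof. by rewrite /res_scal_scale scalerA -scalerAl mul1r scalerA. Qed.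

Fact res_scal_scale1 v : 1 *F: v = v.
Proof. by rewrite /res_scal_scale !scale1r. Qed.

Fact res_scal_scaleDr a u v : a *F: (u + v) = a *F: u + a *F: v.
Proof. exact: scalerDr. Qed.

Fact res_scal_scaleDl v a b : (a + b) *F: v = a *F: v + b *F: v.
Proof. by rewrite /res_scal_scale !scalerDl. Qed.

HB.instance Definition _ := GRing.Zmodule_isLmodule.Build F V0
  res_scal_scaleA res_scal_scale1 res_scal_scaleDr res_scal_scaleDl.

Lemma res_scal_scaleE a (v : V) : a *: (v : V0) = (a%:A : L) *: v.
Proof. by []. Qed.

Fact res_scal_vect_iso : Vector.axiom (\dim {:V} * \dim {:L}) V0.
Proof.
pose f (v : V0) : 'rV[F]_(\dim {:V} * \dim {:L}) :=
  mxvec (\matrix_(i, j) coord (vbasis {:L}) j (coord (vbasis {:V}) i (v : V))).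
pose g (x : 'rV[F]_(\dim {:V} * \dim {:L})) : V0 :=
  \sum_i (\sum_j vec_mx x i j *: (vbasis {:L})`_j) *: ((vbasis {:V})`_i : V).
have fL : linear f.
  move=> a u v; rewrite /f -linearP; congr mxvec; apply/matrixP=> i j.
  rewrite !mxE res_scal_scaleE linearD linearZ /= linearD.
  by rewrite mulr_algl linearZ.
exists f; first exact: fL.
exists g => [v | x].
  rewrite /g /f mxvecK [RHS](coord_vbasis (memvf (v : V))).
  apply: eq_bigr => i _; congr (@GRing.scale L V _ _).
  rewrite [RHS](coord_vbasis (memvf _)).
  by apply: eq_bigr => j _; rewrite mxE.
rewrite /f -[RHS]vec_mxK; congr mxvec; apply/matrixP => i j; rewrite mxE /g.
rewrite coord_sum_free ?(basis_free (vbasisP _)) //.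
by rewrite coord_sum_free ?(basis_free (vbasisP _)).
Qed.

HB.instance Definition _ := Lmodule_hasFinDim.Build F V0 res_scal_vect_iso.

Lemma dim_res_scal : \dim {:V0} = (\dim {:V} * \dim {:L})%N.
Proof. by rewrite dimvf. Qed.

Definition line_map (v : V) (x : L) : V0 := x *: v.

Fact line_map_is_linear v : linear (line_map v).
Proof.
move=> a x y.
by rewrite /line_map res_scal_scaleE scalerDl scalerA -scalerAl mul1r.
Qed.

HB.instance Definition _ v :=
  GRing.isLinear.Build F L V0 _ (line_map v) (line_map_is_linear v).

Definition tau (v : V) : 'Hom(L, V0) := linfun (line_map v).

Lemma tauE v x : tau v x = x *: v.
Proof. by rewrite lfunE. Qed.

(* The L-line <v>_L, regarded as an F-subspace. *)
Definition Lline (v : V) : {vspace V0} := limg (tau v).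

Lemma mem_Lline v (w : V) : ((w : V0) \in Lline v) = (w \in <[v]>%VS).
Proof.
apply/memv_imgP/vlineP => [[x _ ->]|[x ->]]; first by exists x; rewrite tauE.
by exists x; rewrite ?memvf ?tauE.
Qed.

End RestrictionOfScalars.

Arguments res_scal [F L] V.
Arguments tau [F L V] v.
Arguments Lline [F L V] v.

Section RankMetricCodes.

Variables (F : fieldType) (W1 W2 : vectType F).

Definition lrank (f : 'Hom(W1, W2)) : nat := \dim (limg f).

Definition has_min_distance (C : {vspace 'Hom(W1, W2)}) (d : nat) : Prop :=
  (exists2 f, f \in C & f != 0 /\ lrank f = d)
  /\ (forall f, f \in C -> f != 0 -> (d <= lrank f)%N).

Definition in_right_idealiser (C : {vspace 'Hom(W1, W2)}) (Z : 'End(W1))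
    : Prop :=
  forall f, f \in C -> (f \o Z)%VF \in C.

End RankMetricCodes.

Definition rank_metric_code (F : finFieldType) (W1 W2 : vectType F)
    (C : {vspace 'Hom(W1, W2)}) (m n q d : nat) : Prop :=
  [/\ #|F| = q, \dim {:W1} = n, \dim {:W2} = m & has_min_distance C d].

Section CodeOfSubspace.

Variables (F : finFieldType) (L : fieldExtType F) (V : vectType L).
Variable W : vectType F.

(* finvect_type only equips the (finite) space with its finType structure, so
   that the maximum can be written as a bigop. *)
Definition iota_max (U : {vspace res_scal V}) : nat :=
  \max_(v : finvect_type (res_scal V) | v != 0) \dim (U :&: Lline (v : V)).

Definition Gamma (G : 'Hom(res_scal V, W)) (v : V) : 'Hom(L, W) :=
  (G \o tau v)%VF.

Definition in_code (G : 'Hom(res_scal V, W)) (f : 'Hom(L, W)) : Prop :=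
  exists v : V, f = Gamma G v.

End CodeOfSubspace.

(* amull a is omega_a : x |-> a * x. *)
Definition in_Fn (F : fieldType) (L : fieldExtType F) (Z : 'End(L)) : Prop :=
  exists a : L, Z = amull a.

(* Main.v *)
From HB Require Import structures.
Require Import Defs.
From mathcomp Require Import all_boot all_order all_algebra all_field.
Import GRing.Theory.
Local Open Scope ring_scope.

(** Everything rests on one rank formula.  For nonzero [v], the map [tau v]
    is an isomorphism of [L] onto the line [Lline v], so the image of
    [Gamma G v] is the image of that line under [G], and rank-nullity for [G]
    restricted to the line gives
      [lrank (Gamma G v) = \dim {:L} - \dim (lker G :&: Lline v)]
    ([lrank_Gamma]).  The subtracted dimension is at most [iota_max (lker G)],
    with equality for some nonzero [v] ([iota_max_attained]).

    When [iota_max (lker G) < \dim {:L}], the formula makes every [Gamma G v]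
    with [v != 0] of positive rank.  Hence the linear map [v |-> Gamma G v]
    is injective ([lker_GammaL]): its image, the code, has the dimension of
    [res_scal V], and the nonzero codewords are exactly the [Gamma G v] with
    [v != 0], so that the rank formula yields the minimum distance.  The
    statement on the right idealiser is the associativity of scaling:
    [tau v \o omega_a = tau (a *: v)], whence
    [Gamma G v \o omega_a = Gamma G (a *: v)] ([Gamma_comp_amull]). *)

Section CodeOfLinearMap.

Variables (F : finFieldType) (L : fieldExtType F) (V : vectType L).
Variables (W : vectType F).

Lemma lker_tau (v : V) : v != 0 -> lker (tau v) = 0%VS.
Proof.
move=> v_neq0; apply/eqP/lker0P => x y; rewrite !tauE => xvE.
(* Subtraction is to be taken in the L-space V, not in its restriction. *)
have /eqP : x *: v = y *: v :> V by [].
by rewrite -subr_eq0 -scalerBl scaler_eq0 (negPf v_neq0) orbF subr_eq0 => /eqP.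
Qed.

Lemma dim_Lline (v : V) : v != 0 -> \dim (Lline v) = \dim {:L}.
Proof. by move=> v_neq0; rewrite limg_dim_eq // lker_tau ?capv0. Qed.

Lemma dim_cap_Lline_le_iota_max (U : {vspace res_scal V}) (v : V) :
  v != 0 -> (\dim (U :&: Lline v) <= iota_max U)%N.
Proof.
move=> v_neq0.
exact: (@leq_bigmax_cond (finvect_type (res_scal V)) (fun v => v != 0)
         (fun v => \dim (U :&: Lline (v : V))) v).
Qed.

(** A maximum over a finite nonempty range is attained; the hypothesis on
    [V] provides a nonzero vector to make the range nonempty. *)
Lemma iota_max_attained (U : {vspace res_scal V}) :
  (0 < \dim {:V})%N ->
  exists2 v : V, v != 0 & iota_max U = \dim (U :&: Lline v).
Proof.
rewrite lt0n dimv_eq0 -vpick0 => v_neq0.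
have nonempty : (0 < #|[pred v : finvect_type (res_scal V) | v != 0%R]|)%N.
  by apply/card_gt0P; exists (vpick {:V}); rewrite inE.
have [v v0 iotaE] := @eq_bigmax_cond _ _
  (fun v : finvect_type (res_scal V) => \dim (U :&: Lline (v : V))) nonempty.
by exists v.
Qed.

Variable G : 'Hom(res_scal V, W).

Lemma GammaE (v : V) (x : L) : Gamma G v x = G (x *: v).
Proof. by rewrite comp_lfunE tauE. Qed.

(** Rank-nullity for [G] restricted to the line [Lline v]. *)
Lemma lrank_Gamma (v : V) : v != 0 ->
  lrank (Gamma G v) = (\dim {:L} - \dim (lker G :&: Lline v))%N.
Proof.
move=> v_neq0; rewrite /lrank limg_comp -(dim_Lline _ v_neq0).
by rewrite -(limg_ker_dim G (Lline v)) capvC addKn.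
Qed.

Lemma Gamma_comp_amull (v : V) (a : L) :
  (Gamma G v \o amull a)%VF = Gamma G (a *: v).
Proof.
by apply/lfunP => x; rewrite comp_lfunE !GammaE lfunE /= scalerA mulrC.
Qed.

Lemma Gamma_is_linear : linear (Gamma G : res_scal V -> 'Hom(L, W)).
Proof.
move=> a u v; apply/lfunP => x.
rewrite add_lfunE scale_lfunE !GammaE -linearP; congr (G _).
by rewrite !res_scal_scaleE scalerDr !scalerA mulrC.
Qed.

HB.instance Definition _ := GRing.isLinear.Build F (res_scal V) 'Hom(L, W) _
  (Gamma G : res_scal V -> 'Hom(L, W)) Gamma_is_linear.

(** [Gamma G] bundled as an element of a space of linear maps, so that the code
    can be given as its image and measured by rank-nullity. *)
Definition GammaL : 'Hom(res_scal V, 'Hom(L, W)) :=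
  linfun (Gamma G : res_scal V -> 'Hom(L, W)).

Lemma GammaLE (v : V) : GammaL v = Gamma G v.
Proof. by rewrite lfunE. Qed.

Lemma mem_limg_GammaL (f : 'Hom(L, W)) : f \in limg GammaL <-> in_code G f.
Proof.
split=> [/memv_imgP[v _ ->] | [v ->]]; first by exists v; rewrite GammaLE.
by rewrite -GammaLE memv_img ?memvf.
Qed.

(** A nonzero [v] in the kernel would have a line all of whose [\dim {:L}]
    dimensions lie in [lker G], which the bound on [iota_max] excludes. *)
Lemma lker_GammaL : (iota_max (lker G) < \dim {:L})%N -> lker GammaL = 0%VS.
Proof.
move=> iota_lt; apply/eqP; rewrite -subv0; apply/subvP => v.
rewrite memv_ker GammaLE memv0 => /eqP Gv0; apply: contraTT iota_lt => v_neq0.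
have /esym/eqP := lrank_Gamma _ v_neq0.
rewrite Gv0 /lrank lim0g dimv0 subn_eq0 -leqNgt => /leq_trans; apply.
exact: dim_cap_Lline_le_iota_max.
Qed.

Lemma has_min_distance_GammaL :
  (0 < \dim {:V})%N -> (iota_max (lker G) < \dim {:L})%N ->
  has_min_distance (limg GammaL) (\dim {:L} - iota_max (lker G)).
Proof.
move=> V_gt0 iota_lt; split=> [|f /mem_limg_GammaL[v ->] Gv_neq0].
  have [v v_neq0 ->] := iota_max_attained (lker G) V_gt0.
  exists (Gamma G v); first by apply/mem_limg_GammaL; exists v.
  split; last exact: lrank_Gamma.
  by rewrite -GammaLE -memv_ker lker_GammaL // memv0.
have v_neq0 : v != 0.
  by apply: contraNneq Gv_neq0 => ->; rewrite -GammaLE linear0.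
by rewrite lrank_Gamma // leq_sub2l // dim_cap_Lline_le_iota_max.
Qed.

Lemma in_right_idealiser_GammaL (Z : 'End(L)) :
  in_Fn Z -> in_right_idealiser (limg GammaL) Z.
Proof.
case=> a -> f /mem_limg_GammaL[v ->]; apply/mem_limg_GammaL.
by exists (a *: v); apply: Gamma_comp_amull.
Qed.

End CodeOfLinearMap.

Theorem theorem3p1 (q n r k : nat) (F : finFieldType) (L : fieldExtType F)
    (V : vectType L) (W : vectType F)
    (U : {vspace res_scal V}) (G : 'Hom(res_scal V, W))
    (n_gt0 : (0 < n)%N) (r_gt0 : (0 < r)%N) (k_gt0 : (0 < k)%N)
    (k_lt_rn : (k < r * n)%N)
    (card_F : #|F| = q) (dim_L : \dim {:L} = n) (dim_V : \dim {:V} = r)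
    (dim_W : \dim {:W} = (r * n - k)%N) (dim_U : \dim U = k)
    (ker_G : lker G = U) (iota_lt_n : (iota_max U < n)%N) :
  exists C : {vspace 'Hom(L, W)},
    [/\ forall f : 'Hom(L, W), f \in C <-> in_code G f,
        \dim C = (r * n)%N,
        rank_metric_code C (r * n - k) n q (n - iota_max U)
      & forall Z : 'End(L), in_Fn Z -> in_right_idealiser C Z].
Proof.
subst U n r; exists (limg (GammaL F L V W G)); split.
- exact: mem_limg_GammaL.
- by rewrite limg_dim_eq ?dim_res_scal // lker_GammaL ?capv0.
- by split=> //; apply: has_min_distance_GammaL.
- exact: in_right_idealiser_GammaL.
Qed.
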